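(* Let $P\ge 2$, let $j_1<j_2$ be fixed integers (scales), and let $\Xi\subset\mathbb{R}^d$ be a compact parameter set such that each $\Theta\in\Xi$ specifies the law of an $\mathbb{R}^P$-valued operator fractional Brownian motion (OfBm) with wavelet spectrum $E(2^j,\Theta)\in\mathbb{R}^{P\times P}$, $j=j_1,\dots,j_2$. Let the observed process $Y$ be the OfBm with true parameter $\Theta_0\in\Xi$, let $S(2^j)$ be its sample wavelet spectrum from sample size $N$, and let $C_N$ be the objective function $$C_N(\Theta)=\sum_{1\le i_1\le i_2\le P}\ \sum_{j=j_1}^{j_2}\Big(\log_2|S_{i_1,i_2}(2^j)|-\log_2|E_{i_1,i_2}(2^j,\Theta)|\Big)^2,\qquad \Theta\in\Xi .$$ (OfBm, $E$, $S$ are defined in the context.) Assume that $Y$ satisfies (OFBM1)--(OFBM3): - (OFBM1) $Y$ is an $\mathbb{R}^P$-valued OfBm whose Hurst matrix $\underline{\underline{H}}$ (not necessarily diagonalizable) has eigenvalues $h_1,\dots,h_P$ with $0<\Re(h_k)<1$, $k=1,\dots,P$; - (OFBM2) $\mathbb{E}\,Y(t)Y(t)^*$ has full rank for every $t\neq0$; - (OFBM3) $Y$ is time reversible, i.e. $\{Y(-t)\}_{t\in\mathbb{R}}$ and $\{Y(t)\}_{t\in\mathbb{R}}$ have the same finite-dimensional distributions; and that the wavelet $\psi_0\in L^1(\mathbb{R})\cap L^2(\mathbb{R})$ satisfies (W1)--(W3): - (W1) $\int_{\mathbb{R}}t^k\psi_0(t)\,dt=0$ for $k=0,\dots,N_\psi-1$,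 with $N_\psi\ge2$; - (W2) $\mathrm{supp}(\psi_0)$ is a compact interval; - (W3) $\sup_{t\in\mathbb{R}}|\psi_0(t)|(1+|t|)^\alpha<\infty$ for some $\alpha>1$. Suppose in addition that: i) $\Theta_0\in\mathrm{int}\,\Xi$; ii) there is some $j^*\in\{j_1,\dots,j_2\}$ such that for all $\Theta,\Theta'\in\Xi$ with $\Theta\ne\Theta'$ one has $|E_{i_1^*,i_2^*}(2^{j^*},\Theta)|\neq|E_{i_1^*,i_2^*}(2^{j^*},\Theta')|$ for some matrix entry $(i_1^*,i_2^* )$; iii) $E_{i_1,i_2}(2^j,\Theta_0)\neq0$ for all $i_1,i_2=1,\dots,P$ and all $j=j_1,\dots,j_2$; iv) for each $j=j_1,\dots,j_2$, the mapping $\Theta\mapsto E(2^j,\Theta)$ is continuous on $\Xi$ and three times continuously differentiable on $\mathrm{int}\,\Xi$; v) with the column vectors $\Lambda_{i_1,i_2}(2^j,\Theta)$ defined by $\Lambda_{i_1,i_2}(2^j,\Theta)^*=\nabla_\Theta\log_2|E_{i_1,i_2}(2^j,\Theta)|$ (row gradient), $$\det\Big(\sum_{j=j_1}^{j_2}\ \sum_{1\le i_1\le i_2\le P}\Lambda_{i_1,i_2}(2^j,\Theta_0)\Lambda_{i_1,i_2}(2^j,\Theta_0)^*\Big)>0 .$$ Let $\{\widehat\Theta^M_N\}_N$ be a sequence of $\Xi$-valued random vectors such that $C_N(\widehat\Theta_N^M)=\min_{\Theta\in\Xi}C_N(\Theta)$ almost surely for every $N$ and such that $\widehat\Theta^M_N\to\Theta_0$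 in probability. Then, as $N\to\infty$, $$\sqrt N\,(\widehat\Theta^M_N-\Theta_0)\ \xrightarrow{d}\ \mathbf{W},$$ where $$\mathbf{W}\stackrel{d}{=}\Big(\sum_{j=j_1}^{j_2}\sum_{1\le i_1\le i_2\le P}\Lambda_{i_1,i_2}(2^j,\Theta_0)\Lambda_{i_1,i_2}(2^j,\Theta_0)^*\Big)^{-1}\Big(\sum_{j=j_1}^{j_2}\frac{2^{j/2}}{\log 2}\sum_{1\le i_1\le i_2\le P}Z_{i_1,i_2}(2^j)\,\frac{\Lambda_{i_1,i_2}(2^j,\Theta_0)}{E_{i_1,i_2}(2^j,\Theta_0)}\Big)$$ and $\mathbf{Z}=(Z_{i_1,i_2}(2^j))_{1\le i_1\le i_2\le P,\ j=j_1,\dots,j_2}$ is the zero-mean Gaussian vector with covariance matrix $F$ described in the context.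
   Context: **OfBm.** For a real $P\times P$ matrix $\underline{\underline{H}}$ and $a>0$, $a^{\underline{\underline{H}}}:=\sum_{k\ge0}\log^k(a)\,\underline{\underline{H}}^k/k!$. An $\mathbb{R}^P$-valued operator fractional Brownian motion (OfBm) with Hurst matrix $\underline{\underline{H}}$ is a zero-mean Gaussian process $\{Y(t)\}_{t\in\mathbb{R}}$ with stationary increments that is operator self-similar: for every $a>0$, $\{Y(t)\}_{t\in\mathbb{R}}$ and $\{a^{\underline{\underline{H}}}Y(t/a)\}_{t\in\mathbb{R}}$ have the same finite-dimensional distributions. $^*$ denotes (conjugate) transpose. **Wavelet coefficients.** The functions $\psi_{j,k}(t)=2^{-j/2}\psi_0(2^{-j}t-k)$, $(j,k)\in\mathbb{Z}^2$, form an orthonormal basis of $L^2(\mathbb{R})$. The wavelet coefficients of $Y$ are the vectors $D(j,k)=\int_{\mathbb{R}}2^{-j/2}\psi_0(2^{-j}t-k)\,Y(t)\,dt\in\mathbb{R}^P$. **Wavelet spectrum.** $E(2^j,\Theta)=\mathbb{E}\,D(j,k)D(j,k)^*$ (which does not depend on $k$), where the expectation is taken for the OfBm with parameter $\Theta$; its entries are $E_{i_1,i_2}(2^j,\Theta)$. **Sample wavelet spectrum.** $S(2^j)=\frac1{K_j}\sum_{k=1}^{K_j}D(j,k)D(j,k)^*$ with $K_j=N/2^j$, where $D(j,k)$ are the wavelet coefficients of the observed process $Y$ and $N$ is the sample size ($N$ ranges over positive integers such that all $K_j$, $j=j_1,\dots,j_2$, are integers); its entries are $S_{i_1,i_2}(2^j)$.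 **Convention.** $C_N(\Theta)=+\infty$ if one of the logarithms in its definition is not defined (argument zero). **The Gaussian vector $\mathbf{Z}$ (known prior result, may be used).** Under (OFBM1)--(OFBM3) and (W1)--(W3), the covariances $\sqrt{K_jK_{j'}}\,\mathrm{Cov}\big(S_{i_1,i_2}(2^j),S_{i_3,i_4}(2^{j'})\big)$ converge as $N\to\infty$; let $F$ be the symmetric matrix of size $\frac{P(P+1)}2(j_2-j_1+1)$ formed by these limits, indexed by $(i_1,i_2,j)$ with $i_1\le i_2$ and $j_1\le j\le j_2$. Moreover, jointly over these indices, $$\Big(\sqrt{K_j}\,\big(S_{i_1,i_2}(2^j)-E_{i_1,i_2}(2^j,\Theta_0)\big)\Big)_{i_1\le i_2,\ j_1\le j\le j_2}\xrightarrow{d}\mathbf{Z}\sim\mathcal{N}(0,F).$$ *)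

(* Defs.v *)
From HB Require Import structures.
From mathcomp Require Export all_boot all_order all_algebra.
From mathcomp Require Export complex.
From mathcomp Require Export all_classical all_reals all_analysis.
Export Order.TTheory GRing.Theory Num.Theory numFieldNormedType.Exports.

Set Implicit Arguments.
Unset Strict Implicit.
Unset Printing Implicit Defensive.

Local Open Scope classical_set_scope.
Local Open Scope ring_scope.

Definition log2 {R : realType} (x : R) : R := ln x / ln 2.

(** * Laws of random vectors *)

Section random_vectors.
Context {R : realType} {dT : measure_display} {T : measurableType dT}.
Variable Pr : probability T R.

Definition random_vector n (X : T -> 'cV[R]_n) : Prop :=
  forall i, measurable_fun [set: T] (fun w => X w i 0).

(* The standard deviation s may be 0: the law N(0, 0) is the Dirac mass at 0,
   whereas the library's [normal_prob 0 0] is the uniform law on [0, 1]. *)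
Definition centered_normal (X : T -> R) : Prop :=
  measurable_fun [set: T] X /\
  exists s : R, 0 <= s /\ forall A : set R, measurable A ->
    Pr (X @^-1` A) = if s == 0 then \d_(0 : R) A else normal_prob 0 s A.

Definition second_moment n (X : T -> 'cV[R]_n) : 'M[R]_n :=
  \matrix_(i1, i2) fine ('E_Pr[(fun w => X w i1 0 * X w i2 0)%R])%E.

(* Z ~ N(0, F), for a family Z with a finite index set I. *)
Definition centered_gaussian_family (I : finType) (F : I -> I -> R)
    (Z : I -> T -> R) : Prop :=
  (forall c : I -> R, centered_normal (fun w => \sum_u c u * Z u w)) /\
  (forall u v, covariance Pr (Z u) (Z v) = (F u v)%:E).

End random_vectors.

Definition vec_of_family {R : realType} {T : Type} {I : finType}
    (Z : I -> T -> R) (w : T) : 'cV[R]_#|I| :=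
  \col_(k < #|I|) Z (enum_val k) w.

Definition eq_in_law {R : realType} {dT dT' : measure_display}
    {T : measurableType dT} {T' : measurableType dT'} m n
    (Pr : probability T R) (X : T -> 'M[R]_(m, n))
    (Pr' : probability T' R) (X' : T' -> 'M[R]_(m, n)) : Prop :=
  forall B : set 'M[R]_(m, n), <<s [set U | open U] >> B ->
    Pr (X @^-1` B) = Pr' (X' @^-1` B).

Definition cvg_in_distribution {R : realType} {dT dT' : measure_display}
    {T : measurableType dT} {T' : measurableType dT'} n
    (Pr : probability T R) (X : nat -> T -> 'cV[R]_n) (F : set_system nat)
    (Pr' : probability T' R) (W : T' -> 'cV[R]_n) : Prop :=
  forall f : 'cV[R]_n -> R, continuous f ->
    (exists M : R, forall x, `|f x| <= M) ->
    (fun N => 'E_Pr[(fun w => f (X N w))%R])%E @ F -->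
      ('E_Pr'[(fun w => f (W w))%R])%E.

Definition cvg_in_probability {R : realType} {dT : measure_display}
    {T : measurableType dT} n (Pr : probability T R)
    (X : nat -> T -> 'cV[R]_n) (F : set_system nat) (x : 'cV[R]_n) : Prop :=
  forall e : R, 0 < e ->
    (fun N => Pr [set w | e <= `|X N w - x|]) @ F --> 0%E.

(** * Operator fractional Brownian motion *)

Section ofbm.
Context {R : realType} {dT : measure_display} {T : measurableType dT} {p : nat}.
Implicit Types (Pr : probability T R) (X Y : R -> T -> 'cV[R]_p) (H : 'M[R]_p).

(* a ^ H = sum_k (log a)^k H^k / k!, the series being taken entrywise. *)
Definition powmx (a : R) H : 'M[R]_p :=
  \matrix_(i, j) limn (series (fun k => ln a ^+ k / k`!%:R * (H ^+ k) i j)).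

Definition same_fdd Pr X Y : Prop :=
  forall n (t : 'I_n -> R),
    eq_in_law Pr (fun w => \matrix_(i < p, k < n) X (t k) w i 0)
              Pr (fun w => \matrix_(i < p, k < n) Y (t k) w i 0).

Definition centered_gaussian_process Pr Y : Prop :=
  forall n (t : 'I_n -> R) (c : 'M[R]_(n, p)),
    centered_normal Pr (fun w => \sum_k \sum_i c k i * Y (t k) w i 0).

Definition stationary_increments Pr Y : Prop :=
  forall h : R, same_fdd Pr (fun t w => Y (t + h) w - Y h w)
                            (fun t w => Y t w - Y 0 w).

Definition operator_self_similar Pr Y H : Prop :=
  forall a : R, 0 < a ->
    same_fdd Pr Y (fun t w => powmx a H *m Y (t / a) w).

Definition ofbm Pr Y H : Prop :=
  [/\ centered_gaussian_process Pr Y, stationary_increments Pr Y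
    & operator_self_similar Pr Y H].

Definition OFBM1 Pr Y : Prop :=
  exists H, ofbm Pr Y H /\
    forall h : complex R, eigenvalue (map_mx (real_complex R) H) h ->
      0 < complex.Re h < 1.

Definition OFBM2 Pr Y : Prop :=
  forall t : R, t != 0 -> \rank (second_moment Pr (Y t)) = p.

Definition OFBM3 Pr Y : Prop := same_fdd Pr (fun t => Y (- t)) Y.

(* The joint measurability under which the path integrals defining the
   wavelet coefficients are meaningful. *)
Definition measurable_process Y : Prop :=
  forall i, measurable_fun [set: R * T] (fun z => Y z.1 z.2 i 0).

End ofbm.

(** * Wavelets *)

Section wavelet.
Context {R : realType}.
Local Notation mu := (@lebesgue_measure R).
Variable psi : R -> R.

Definition wavelet (j k : int) (t : R) : R :=
  2 `^ (- (j%:~R / 2)) * psi (2 ^ (- j) * t - k%:~R).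

(* Real L^2: an orthonormal system whose linear span is dense. *)
Definition wavelet_basis : Prop :=
  [/\ forall j k, wavelet j k \in Lfun mu 2%:E,
      forall j k j' k',
        (\int[mu]_t (wavelet j k t * wavelet j' k' t)%:E =
         (((j == j') && (k == k'))%:R)%:E)%E
    & forall f : R -> R, f \in Lfun mu 2%:E -> forall e : R, 0 < e ->
        exists s : seq (R * (int * int)),
          ('N[mu]_(2%:E)[(fun t =>
             (f t - \sum_(c <- s) c.1 * wavelet c.2.1 c.2.2 t)%:E)] < e%:E)%E].

Definition W1 (Npsi : nat) : Prop :=
  (2 <= Npsi)%N /\
  forall k : nat, (k < Npsi)%N ->
    (\int[mu]_t (t ^+ k * psi t)%R%:E = 0)%E.

Definition W2 : Prop :=
  exists a b : R, a <= b /\ closure [set t | psi t != 0] = `[a, b]%classic.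

Definition W3 : Prop :=
  exists alpha : R, 1 < alpha /\
    exists M : R, forall t, `|psi t| * (1 + `|t|) `^ alpha <= M.

Definition wavelet_conditions (Npsi : nat) : Prop :=
  [/\ psi \in Lfun mu 1, psi \in Lfun mu 2%:E & wavelet_basis] /\
  [/\ W1 Npsi, W2 & W3].

End wavelet.

(** * Wavelet spectra and the objective function *)

(* The triples (i1, i2, j) with i1 <= i2 and j1 <= j <= j2. *)
Definition spectrum_index (p : nat) (j1 j2 : int) : finType :=
  {u : 'I_p * 'I_p * 'I_(`|j2 - j1|%N.+1) | (u.1.1 <= u.1.2)%N}.

Section index.
Context {p : nat} {j1 j2 : int} (u : spectrum_index p j1 j2).
Definition idx_row : 'I_p := (val u).1.1.
Definition idx_col : 'I_p := (val u).1.2.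
Definition idx_scale : int := j1 + (nat_of_ord (val u).2)%:Z.
End index.

(* K_j = N / 2^j; N is an admissible sample size if all K_j are integers. *)
Definition Kscale (R : realType) (j : int) (N : nat) : R := N%:R / 2 ^ j.

Definition sample_size (R : realType) (j1 j2 : int) (N : nat) : Prop :=
  (0 < N)%N /\
  forall j : int, j1 <= j <= j2 -> Kscale R j N \is a Num.nat.

Definition sample_sizes (R : realType) (j1 j2 : int) : set_system nat :=
  within [set N | sample_size R j1 j2 N] \oo.

Section spectrum.
Context {R : realType} {dT : measure_display} {T : measurableType dT} {p : nat}.
Variables (psi : R -> R) (Y : R -> T -> 'cV[R]_p).
Implicit Types (Pr : probability T R) (j k : int) (N : nat).

Definition wavelet_coef j k (w : T) : 'cV[R]_p :=
  \col_i Rintegral (@lebesgue_measure R) [set: R]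
           (fun t => wavelet psi j k t * Y t w i 0).

(* E D(j,k) D(j,k)^*, taken at k = 0 since it does not depend on k. *)
Definition wavelet_spectrum Pr j : 'M[R]_p :=
  second_moment Pr (wavelet_coef j 0).

Definition sample_spectrum j N (w : T) : 'M[R]_p :=
  (Kscale R j N)^-1 *:
    \sum_(1 <= k < (Num.truncn (Kscale R j N)).+1)
       wavelet_coef j k%:Z w *m (wavelet_coef j k%:Z w)^T.

Definition normalized_covariance Pr (j1 j2 : int) (u v : spectrum_index p j1 j2) N : R :=
  Num.sqrt (Kscale R (idx_scale u) N * Kscale R (idx_scale v) N) *
  fine (covariance Pr
    (fun w => sample_spectrum (idx_scale u) N w (idx_row u) (idx_col u))
    (fun w => sample_spectrum (idx_scale v) N w (idx_row v) (idx_col v))).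

Definition limit_covariance Pr (j1 j2 : int) (u v : spectrum_index p j1 j2) : R :=
  lim (normalized_covariance Pr u v @ sample_sizes R j1 j2).

Definition centered_spectrum Pr (j1 j2 : int) N (u : spectrum_index p j1 j2) (w : T) : R :=
  Num.sqrt (Kscale R (idx_scale u) N) *
  (sample_spectrum (idx_scale u) N w (idx_row u) (idx_col u)
   - wavelet_spectrum Pr (idx_scale u) (idx_row u) (idx_col u)).

Section objective.
Context {d : nat} (Pr : 'cV[R]_d -> probability T R) (j1 j2 : int).
Local Notation index := (spectrum_index p j1 j2).

(* E_{i1,i2}(2^j, Theta), for u = (i1, i2, j). *)
Definition spectrum_entry (u : index) (Theta : 'cV[R]_d) : R :=
  wavelet_spectrum (Pr Theta) (idx_scale u) (idx_row u) (idx_col u).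

Definition objective N (w : T) (Theta : 'cV[R]_d) : \bar R :=
  let S u := sample_spectrum (idx_scale u) N w (idx_row u) (idx_col u) in
  if [exists u : index, (S u == 0) || (spectrum_entry u Theta == 0)]
  then +oo%E
  else (\sum_(u : index)
          (log2 `|S u| - log2 `|spectrum_entry u Theta|) ^+ 2)%:E.

Definition gradient (f : 'cV[R]_d -> R) (x : 'cV[R]_d) : 'cV[R]_d :=
  \col_l 'D_(delta_mx l 0) f x.

Definition Lambda (u : index) (Theta : 'cV[R]_d) : 'cV[R]_d :=
  gradient (fun Theta' => log2 `|spectrum_entry u Theta'|) Theta.

Definition Lambda_gram (Theta : 'cV[R]_d) : 'M[R]_d :=
  \sum_(u : index) Lambda u Theta *m (Lambda u Theta)^T.

(* The limit W, as a function of a realization of Z. *)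
Definition limit_vector (Theta : 'cV[R]_d) (Z : index -> R) : 'cV[R]_d :=
  invmx (Lambda_gram Theta) *m
  \sum_(u : index)
     (2 `^ ((idx_scale u)%:~R / 2) / ln 2 * (Z u / spectrum_entry u Theta))
       *: Lambda u Theta.

End objective.
End spectrum.

Arguments limit_covariance {R dT T p} psi Y Pr j1 j2 u v.
Arguments centered_spectrum {R dT T p} psi Y Pr j1 j2 N u w.
Arguments Lambda_gram {R dT T p} psi Y {d} Pr j1 j2 Theta.
Arguments limit_vector {R dT T p} psi Y {d} Pr j1 j2 Theta Z.

(* C^k on an open set U: all partial derivatives up to order k exist on U
   and are continuous there. *)
Fixpoint cont_diff_on {R : realType} {d : nat} (k : nat) (U : set 'cV[R]_d)
    (f : 'cV[R]_d -> R) : Prop :=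
  (forall x, U x -> {for x, continuous f}) /\
  (if k is k'.+1 then
     forall l : 'I_d,
       (forall x, U x -> derivable f x (delta_mx l 0)) /\
       cont_diff_on k' U (fun x => 'D_(delta_mx l 0) f x)
   else True).

(* The known asymptotic normality of the sample wavelet spectrum, for the
   process Y under Pr and a vector Z on an auxiliary probability space. *)
Definition sample_spectrum_clt {R : realType} {dT dT' : measure_display}
    {T : measurableType dT} {T' : measurableType dT'} {p : nat}
    (Pr : probability T R) (Y : R -> T -> 'cV[R]_p)
    (psi : R -> R) (Npsi : nat) (j1 j2 : int)
    (Q : probability T' R) (Z : spectrum_index p j1 j2 -> T' -> R) : Prop :=
  measurable_process Y -> OFBM1 Pr Y -> OFBM2 Pr Y -> OFBM3 Pr Y ->
  wavelet_conditions psi Npsi ->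
  (forall u v : spectrum_index p j1 j2,
     cvg (normalized_covariance psi Y Pr u v @ sample_sizes R j1 j2)) /\
  (centered_gaussian_family Q (limit_covariance psi Y Pr j1 j2) Z ->
   cvg_in_distribution Pr
     (fun N => vec_of_family (centered_spectrum psi Y Pr j1 j2 N))
     (sample_sizes R j1 j2) Q (vec_of_family Z)).

(* Main.v *)
(** Near [Theta0] the minimizer solves the score equation
    [sum_u (log2 |S u| - log2 |E u Theta|) * grad (log2 |E u|) Theta = 0].
    Expanding [log2 |S u|] around [E u Theta0] and [log2 |E u Theta|] around
    [Theta0] turns it into
    [Gram (Theta - Theta0) = sum_u (S u - E u) / (E u ln 2) * Lambda u + remainder],
    where, for every [eps], the remainder is at most [eps * max_u |S u - E u|]
    once [Theta] and [S] are close to [Theta0] and [E].  As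
    [sqrt N = 2^(j/2) * sqrt (K_j)], multiplication by [sqrt N] makes the main
    term a fixed linear image of the vector of centered spectra.  That vector
    converges in law, hence is tight, so that the remainder vanishes in
    probability and Slutsky's theorem concludes. *)

Require Import Defs.
From mathcomp Require Import measurable_realfun ring lra.

Set Implicit Arguments.
Unset Strict Implicit.
Unset Printing Implicit Defensive.

Local Open Scope classical_set_scope.
Local Open Scope ring_scope.

(** * Column vectors: norm, compactness, measurability *)

Section matrix_norm.
Context {R : realType}.

Lemma coord_le_mx_norm m n (A : 'M[R]_(m, n)) i j : `|A i j| <= `|A|.
Proof.
by rewrite [leRHS]/Num.norm/= mx_normrE; exact: (le_bigmax _ _ (i, j)).
Qed.

Lemma mx_norm_le m n (A : 'M[R]_(m, n)) (M : R) :
  0 <= M -> (forall i j, `|A i j| <= M) -> `|A| <= M.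
Proof.
move=> M0 AM; rewrite [leLHS]/Num.norm/= mx_normrE.
by apply/bigmax_leP; split => // -[i j] _; exact: AM.
Qed.

Lemma mx_norm_lt m n (A : 'M[R]_(m, n)) (M : R) :
  0 < M -> (forall i j, `|A i j| < M) -> `|A| < M.
Proof.
move=> M0 AM; rewrite [ltLHS]/Num.norm/= mx_normrE.
by apply/bigmax_ltP; split => // -[i j] _; exact: AM.
Qed.

Lemma mx_norm_mulmx m n k (A : 'M[R]_(m, n)) (B : 'M[R]_(n, k)) :
  `|A *m B| <= n%:R * `|A| * `|B|.
Proof.
apply: mx_norm_le => [|i j]; first by rewrite !mulr_ge0.
rewrite mxE (le_trans (ler_norm_sum _ _ _))//.
rewrite (@le_trans _ _ (\sum_(l < n) `|A| * `|B|))//.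
  by apply: ler_sum => l _; rewrite normrM ler_pM// coord_le_mx_norm.
by rewrite sumr_const card_ord -mulrA mulr_natl.
Qed.

Lemma mx_norm_trmx m n (A : 'M[R]_(m, n)) : `|A^T| = `|A|.
Proof.
apply/eqP; rewrite eq_le; apply/andP; split; apply: mx_norm_le => // i j.
  by rewrite mxE coord_le_mx_norm.
by have := coord_le_mx_norm A^T j i; rewrite mxE.
Qed.

Lemma mulmx_continuous m n k (A : 'M[R]_(m, n)) :
  continuous (fun B : 'M[R]_(n, k) => A *m B).
Proof.
move=> B; apply/(@cvgrPdist_lt _ _ _ _ (nbhs_filter B)) => e e0.
have c0 : 0 < n%:R * `|A| + 1 by rewrite ltr_wpDl// mulr_ge0.
apply/nbhs_ballP; exists (e / (n%:R * `|A| + 1)) => /=; first exact: divr_gt0.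
move=> C; rewrite -ball_normE/= ltr_pdivlMr// mulrC => BC.
rewrite -mulmxBr (le_lt_trans (mx_norm_mulmx _ _))// (le_lt_trans _ BC)//.
by rewrite ler_wpM2r// lerDl.
Qed.

(** Transposition is an isometry onto row vectors, for which closed bounded sets are compact. *)
Lemma compact_closed_ball_cV n (M : R) : compact [set v : 'cV[R]_n | `|v| <= M].
Proof.
have -> : [set v : 'cV[R]_n | `|v| <= M] =
    trmx @` [set r : 'rV[R]_n | `|r| <= M].
  apply/seteqP; split => [v /= vM|_ [r /= rM <-]]; last by rewrite /= mx_norm_trmx.
  by exists v^T; rewrite /= ?trmxK// mx_norm_trmx.
apply: continuous_compact.
  apply: continuous_subspaceT => r.
  apply/(@cvgrPdist_lt _ _ _ _ (nbhs_filter r)) => e e0.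
  apply/nbhs_ballP; exists e => //= s; rewrite -ball_normE/=.
  by rewrite -linearB mx_norm_trmx.
apply: bounded_closed_compact.
  exists M; split; first exact: num_real.
  by move=> x Mx r /= rM; rewrite (le_trans rM)// ltW.
rewrite (_ : [set r | _] = (fun r : 'rV[R]_n => `|r|) @^-1` [set x | x <= M])//.
by apply: closed_comp => [r _|]; [exact: norm_continuous|exact: closed_le].
Qed.

End matrix_norm.

Section measurability.
Context {R : realType} {dT : measure_display} {T : measurableType dT}.

(** Measurability is known coordinatewise only. An open set is a countable union of balls, and a
    ball of the sup norm is a finite intersection of coordinate conditions. *)
Lemma measurable_random_vector_open n (X : T -> 'cV[R]_n) (U : set 'cV[R]_n) :
  random_vector X -> open U -> measurable (X @^-1` U).
Proof.
move=> mX oU.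
(* Balls with rational centres and radii 1/(k+1) form a countable base. *)
pose B (q : {ffun 'I_n -> rat}) k := ball (\col_i (ratr (q i)) : 'cV[R]_n) k.+1%:R^-1.
pose F (z : {ffun 'I_n -> rat} * nat) : set T :=
  if `[< B z.1 z.2 `<=` U >] then X @^-1` B z.1 z.2 else set0.
have -> : X @^-1` U = \bigcup_z F z.
  apply/seteqP; split => [w /= Uw|w [z _]]; last first.
    by rewrite /F; case: ifPn => [/asboolP + Bw|//]; exact.
  have := open_nbhs_nbhs (conj oU Uw) => /nbhs_ballP[e /= e0 eU].
  have [k ke] : exists k, k.+1%:R^-1 < e / 2 :> R.
    have [k _ /(_ _ (leqnn _))] := near_infty_natSinv_lt (PosNum (divr_gt0 e0 (ltr0n _ 2))).
    by exists k.
  (* The point [X w] and every point of the ball lie within [k.+1%:R^-1 < e / 2] of the centre [q],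
     so the ball stays inside the [e]-ball around [X w]. *)
  have /choice[q qP] : forall i, exists q : rat, `|ratr q - X w i 0| < k.+1%:R^-1.
    move=> i; have : X w i 0 - k.+1%:R^-1 < X w i 0 + k.+1%:R^-1.
      by rewrite ltrBlDr -addrA ltrDl addr_gt0.
    move=> /rat_in_itvoo[q]; rewrite in_itv/= => /andP[q1 q2].
    by exists q; rewrite ltr_distl q1.
  have Bq : B (finfun q) k (X w).
    rewrite /B -ball_normE/=; apply: mx_norm_lt; first by rewrite invr_gt0.
    by move=> i j; rewrite !mxE ord1 ffunE.
  exists (finfun q, k) => //; rewrite /F/= ifT//; apply/asboolP => y By; apply: eU.
  rewrite -ball_normE/= (le_lt_trans (ler_distD (\col_i ratr (finfun q i)) _ _))//.
  rewrite (splitr e) ltrD//; last first.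
    by move: By; rewrite /B -ball_normE/= => /lt_trans; exact.
  by move: Bq; rewrite /B -ball_normE/= distrC => /lt_trans; exact.
apply: countable_bigcupT_measurable => [|[q k]]; first exact: countableP.
rewrite /F; case: ifPn => // _.
have -> : X @^-1` B q k =
    \bigcap_(i in [set: 'I_n]) (fun w => X w i 0) @^-1` (ball (ratr (q i) : R) k.+1%:R^-1).
  apply/seteqP; split => w /= => [[_ Xw] i _|Xw]; first by have := Xw i 0; rewrite mxE.
  by split=> [|i j]; rewrite ?invr_gt0// mxE ord1; exact: Xw.
apply: fin_bigcap_measurable => [|i _]; first exact: finite_finset.
rewrite -[X in measurable X]setTI.
apply: mX => //; apply: open_measurable; exact: ball_open.
Qed.

Lemma measurable_continuous_random_vector n (X : T -> 'cV[R]_n) (f : 'cV[R]_n -> R) :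
  random_vector X -> continuous f -> measurable_fun [set: T] (f \o X).
Proof.
move=> mX cf; apply: (measurability _ (RGenOpens.measurableE R)).
move=> _ [_ [a [b ->] <-]]; rewrite setTI comp_preimage.
apply: measurable_random_vector_open => //.
by apply: open_comp => [v _|]; [exact: cf|exact: interval_open].
Qed.

Lemma random_vector_mulmx m n (A : 'M[R]_(m, n)) (X : T -> 'cV[R]_n) :
  random_vector X -> random_vector (fun w => A *m X w).
Proof.
move=> mX i; under eq_fun do rewrite mxE.
by apply: measurable_sum => k; apply: measurable_funM.
Qed.

Lemma random_vectorB n (X Y : T -> 'cV[R]_n) :
  random_vector X -> random_vector Y -> random_vector (fun w => X w - Y w).
Proof.
by move=> mX mY i; under eq_fun do rewrite !mxE; exact: measurable_funB.
Qed.

Lemma random_vectorZ n (a : R) (X : T -> 'cV[R]_n) :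
  random_vector X -> random_vector (fun w => a *: X w).
Proof.
by move=> mX i; under eq_fun do rewrite !mxE; exact: measurable_funM.
Qed.

Lemma measurable_random_vector_norm n (X : T -> 'cV[R]_n) (e : R) :
  random_vector X -> measurable [set w | e <= `|X w|].
Proof.
move=> mX; rewrite -[X in measurable X]setTI.
have /(_ measurableT `[e, +oo[%classic (measurable_itv _)) :=
  measurable_continuous_random_vector mX (@norm_continuous _ _).
by congr measurable; congr setI; apply/seteqP; split => w /=; rewrite in_itv/= andbT.
Qed.

End measurability.

(** * Tightness and Slutsky's theorem *)

Section expectation_bounded.
Context {R : realType} {dT : measure_display} {T : measurableType dT}.
Variable Pr : probability T R.

Lemma integrable_bounded (f : T -> R) (M : R) :
  measurable_fun [set: T] f -> (forall w, `|f w| <= M) ->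
  Pr.-integrable [set: T] (EFin \o f).
Proof.
move=> mf fM; apply: (@le_integrable _ _ _ _ _ measurableT _ (EFin \o cst M)).
- exact/measurable_EFinP.
- by move=> w _ /=; rewrite lee_fin (le_trans (fM w))// ler_norm.
- exact: finite_measure_integrable_cst.
Qed.

Lemma expectation_bounded_fin_num (f : T -> R) (M : R) :
  measurable_fun [set: T] f -> (forall w, `|f w| <= M) ->
  'E_Pr[f]%E \is a fin_num.
Proof.
move=> mf fM; rewrite unlock.
by apply: integrable_fin_num => //; exact: integrable_bounded fM.
Qed.

(** The modulus of [f - g] is at most [e] off [A] and at most [2 * M] on [A], hence is dominated by
    [e + 2 * M * \1_A]. *)
Lemma expectation_diff_le (f g : T -> R) (M e : R) (A : set T) :
  measurable_fun [set: T] f -> measurable_fun [set: T] g -> measurable A ->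
  (forall w, `|f w| <= M) -> (forall w, `|g w| <= M) ->
  0 <= e -> (forall w, ~ A w -> `|f w - g w| <= e) ->
  `|fine ('E_Pr[f])%E - fine ('E_Pr[g])%E| <= e + 2 * M * fine (Pr A).
Proof.
move=> mf mg mA fM gM e0 fg.
have If := integrable_bounded mf fM; have Ig := integrable_bounded mg gM.
have PA : Pr A \is a fin_num by exact: fin_num_measure.
rewrite unlock -fineB ?integrable_fin_num// -integralB_EFin//.
rewrite -lee_fin -fine_abse ?fineK; last 2 first.
- by rewrite abse_fin_num integrable_fin_num//; exact: integrableB.
- by apply: integrable_fin_num => //; exact: integrableB.
have M0 (w : T) : 0 <= M by exact: le_trans (normr_ge0 _) (fM w).
rewrite (le_trans (le_abse_integral _ _ _))//.
  exact/measurable_EFinP/measurable_funB.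
have mh : measurable_fun [set: T] (fun w => e + 2 * M * \1_A w : R).
  by apply: measurable_funD => //; apply: measurable_funM => //; exact: measurable_indic.
rewrite (@le_trans _ _ (\int[Pr]_w (e + 2 * M * \1_A w)%:E)%E)//.
  apply: ge0_le_integral => //.
  - by apply/measurable_EFinP; apply: measurableT_comp => //; exact: measurable_funB.
  - by apply/measurable_EFinP.
  move=> w _ /=; rewrite lee_fin indicE; have [wA|wA] := boolP (w \in A).
    rewrite mulr1 (le_trans (ler_normB _ _))// ler_wpDl// mulr2n mulrDl !mul1r.
    by rewrite lerD.
  by rewrite mulr0 addr0 fg// -notin_setE.
under eq_integral do rewrite EFinD EFinM.
rewrite integralD//; last 2 first.
- exact: finite_measure_integrable_cst.
- apply: integrableZl => //; apply: (@integrable_bounded _ 1) => [|w].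
    exact: measurable_indic.
  by rewrite indicE; case: (_ \in _); rewrite ?normr1 ?normr0.
rewrite integral_cst// [X in (_ * X + _)%E]probability_setT mule1 integralZl//; last first.
  apply: (@integrable_bounded _ 1) => [|w]; first exact: measurable_indic.
  by rewrite indicE; case: (_ \in _); rewrite ?normr1 ?normr0.
by rewrite integral_indic// setIT EFinD (EFinM (2 * M)) fineK.
Qed.

End expectation_bounded.

Section convergence_in_distribution.
Context {R : realType} {dT dT' : measure_display}
  {T : measurableType dT} {T' : measurableType dT'}.
Variables (Pr : probability T R) (Q : probability T' R).
Context {F : set_system nat} {FF : Filter F}.

Lemma cvge_near_lt (G : set_system nat) (u : nat -> \bar R) (l a : \bar R) :
  (u @ G --> l -> l < a -> \forall N \near G, u N < a)%E.
Proof.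
move=> ul la; apply: (ul [set x | x < a]%E).
by apply: open_nbhs_nbhs; split => //; exact: open_ereal_lt_ereal.
Qed.

(* A continuous function above the indicator of [k.+1 <= `|v|] that tends to 0
   pointwise as k grows. *)
Definition cutoff n (k : nat) (v : 'cV[R]_n) : R := Num.min 1 (`|v| * k.+1%:R^-1).

Lemma cutoff_ge0 n k (v : 'cV[R]_n) : 0 <= cutoff k v.
Proof. by rewrite le_min ler01/= divr_ge0. Qed.

Lemma cutoff_le1 n k (v : 'cV[R]_n) : `|cutoff k v| <= 1.
Proof. by rewrite ger0_norm ?cutoff_ge0// ge_min lexx. Qed.

Lemma continuous_cutoff n k : continuous (@cutoff n k).
Proof.
move=> v; apply: (@continuous_min _ _ (cst 1) (fun v => `|v| * k.+1%:R^-1) v).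
  exact: cst_continuous.
by apply: continuousM; [exact: norm_continuous|exact: cst_continuous].
Qed.

Lemma cvg_cutoff n (v : 'cV[R]_n) : cutoff k v @[k --> \oo] --> (0 : R).
Proof.
apply: (@squeeze_cvgr _ _ _ _ (cst 0) (fun k => `|v| * k.+1%:R^-1)).
- by apply: nearW => k; rewrite cutoff_ge0/= ge_min lexx orbT.
- exact: cvg_cst.
- by rewrite -[X in _ --> X](mulr0 `|v|); apply: cvgMr; exact: cvg_harmonic.
Qed.

(** By dominated convergence some [cutoff k] has expectation below [e] under the law of [W].
    Convergence in law passes this bound on to [V N], and [cutoff k] dominates the indicator of the
    tail beyond [M = k.+1]. *)
Lemma cvg_in_distribution_tight n (V : nat -> T -> 'cV[R]_n) (W : T' -> 'cV[R]_n)
    (e : R) :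
  random_vector W -> (\forall N \near F, random_vector (V N)) ->
  cvg_in_distribution Pr V F Q W -> 0 < e ->
  exists M : R, \forall N \near F, (Pr [set w | M <= `|V N w|]%R <= e%:E)%E.
Proof.
move=> mW mV VW e0.
have mg k : measurable_fun [set: T'] (cutoff k \o W).
  by apply: measurable_continuous_random_vector => //; exact: continuous_cutoff.
have : ('E_Q[cutoff k \o W])%E @[k --> \oo] --> (0 : \bar R)%E.
  rewrite unlock -[X in _ --> X](integral0 Q [set: T']).
  apply: (@dominated_cvg _ _ _ _ _ _ _ _ (cst 1%E)) => //.
  - by move=> k; exact/measurable_EFinP.
  - move=> w _; apply: cvg_EFin; first by apply: nearW.
    exact: cvg_cutoff.
  - exact: finite_measure_integrable_cst.
  - by move=> k w _; rewrite /= lee_fin cutoff_le1.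
move=> Wk; have /filter_ex[k ke] := cvge_near_lt Wk (e0 : (0 < e%:E)%E).
exists k.+1%:R.
have /cvge_near_lt/(_ ke) VNe := VW _ (@continuous_cutoff n k) (ex_intro _ 1 (cutoff_le1 k)).
near=> N.
have mVN : random_vector (V N) by near: N.
have : ('E_Pr[(fun w => cutoff k (V N w))] < e%:E)%E by near: N.
move=> /ltW; apply: le_trans; rewrite -(setIT [set _ | _]) -integral_indic//; last first.
  exact: measurable_random_vector_norm.
rewrite unlock; apply: ge0_le_integral => //.
- apply/measurable_EFinP; apply: measurable_indic; exact: measurable_random_vector_norm.
- apply/measurable_EFinP.
  by apply: measurable_continuous_random_vector => //; exact: continuous_cutoff.
move=> w _ /=; rewrite lee_fin indicE; case: (boolP (w \in _)) => [|_]; last exact: cutoff_ge0.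
by rewrite inE/= => kw; rewrite le_min lexx/= ler_pdivlMr// mul1r.
Unshelve. all: by end_near. Qed.

(** Uniform continuity around the compact image of a ball under [L]; the point [y] may lie off that
    image, as a perturbed vector does in Slutsky's theorem. *)
Lemma compact_unif_continuous_mulmx m n (L : 'M[R]_(m, n)) (f : 'cV[R]_m -> R)
    (M e : R) : continuous f -> 0 < e ->
  exists2 r : R, 0 < r & forall v y, `|v| <= M -> `|y - L *m v| < r ->
    `|f y - f (L *m v)| <= e.
Proof.
move=> cf e0.
have /compact_near_coveringP/near_covering_withinP := @compact_closed_ball_cV R n M.
(* The parameter of the covering argument is the radius: what holds near each [v] for all small
   radii holds for all small radii uniformly over the ball. *)
move=> /(_ R (0^'+) (fun r v => forall y, `|y - L *m v| < r -> `|f y - f (L *m v)| <= e)).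
move=> /(_ _)[|r /= r0 rP].
  move=> v _.
  have /cvgrPdist_lt/(_ (e / 2)) := cf (L *m v).
  rewrite divr_gt0// => /(_ isT)/nbhs_ballP[r /= r0 rP].
  have /nbhs_ballP[s /= s0 sP] : \forall v' \near v, `|L *m v - L *m v'| < r / 2.
    have /(@cvgrPdist_lt _ _ _ _ (nbhs_filter v)) := @mulmx_continuous R m n 1 L v.
    by apply; rewrite divr_gt0.
  near=> v' d.
  have dr : d < r / 2 by near: d; apply: nbhs_right_lt; rewrite divr_gt0.
  move=> _ y yd.
  have Lvr : `|L *m v - L *m v'| < r / 2.
    by apply: sP; near: v'; exact: nbhsx_ballx.
  rewrite (le_trans (ler_distD (f (L *m v)) _ _))// (splitr e) lerD//.
    rewrite distrC ltW//; apply: rP; rewrite -ball_normE/=.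
    rewrite (le_lt_trans (ler_distD (L *m v') _ _))// (splitr r) ltrD// distrC.
    exact: lt_trans dr.
  rewrite ltW//; apply: rP; rewrite -ball_normE/= (lt_trans Lvr)//.
  by rewrite gtr_pMr// invf_lt1// ltr1n.
(* Admissible radii are those in the open interval from 0 to [r], so [r / 2] is one of them. *)
have r20 : 0 < r / 2 by rewrite divr_gt0.
exists (r / 2) => // v y vM yv; apply: (rP (r / 2)) => //=.
by rewrite sub0r normrN gtr0_norm// gtr_pMr// invf_lt1// ltr1n.
Unshelve. all: by end_near. Qed.

(** The expectations of [f (L *m V N)] converge because [f] composed with [L] is again bounded and
    continuous. Replacing [L *m V N] by [X N] costs little: off two events of small probability,
    given by tightness and by the convergence in probability, uniform continuity bounds the change
    of [f]. *)
Lemma slutsky m n (L : 'M[R]_(m, n)) (X : nat -> T -> 'cV[R]_m)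
    (V : nat -> T -> 'cV[R]_n) (W : T' -> 'cV[R]_n) :
  random_vector W -> (\forall N \near F, random_vector (V N)) ->
  (\forall N \near F, random_vector (X N)) ->
  cvg_in_distribution Pr V F Q W ->
  cvg_in_probability Pr (fun N w => X N w - L *m V N w) F 0 ->
  cvg_in_distribution Pr X F Q (fun w => L *m W w).
Proof.
move=> mW mV mX VW XLV f cf [B fB].
have cfL : continuous (fun v => f (L *m v)).
  by move=> v; apply: (@continuous_comp _ _ _ (mulmx L) f); [exact: mulmx_continuous|exact: cf].
have /fineK lE : ('E_Q[(fun w => f (L *m W w))])%E \is a fin_num.
  apply: (@expectation_bounded_fin_num _ _ _ _ _ B) => //.
  exact: (measurable_continuous_random_vector mW cfL).
have := VW _ cfL (ex_intro _ B (fun v => fB (L *m v))).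
rewrite -lE => /fine_cvgP[_ /cvgrPdist_le fVW].
have mfX : \forall N \near F, measurable_fun [set: T] (fun w => f (X N w)).
  by apply: filterS mX => N mXN; exact: (measurable_continuous_random_vector mXN cf).
apply/fine_cvgP; split.
  by apply: filterS mfX => N mfXN; exact: expectation_bounded_fin_num mfXN _.
apply/cvgrPdist_le => e e0.
have e4 : 0 < e / 4 by rewrite divr_gt0.
(* A strictly positive bound of [f], by which one can divide. *)
pose b := `|B| + 1; have b0 : 0 < b by rewrite ltr_wpDl.
have fb v : `|f v| <= b.
  by rewrite (le_trans (fB v))// (le_trans (ler_norm _))// lerDl.
have eb : 0 < e / (8 * b) by rewrite divr_gt0// mulr_gt0.
have [M MP] := cvg_in_distribution_tight mW mV VW eb.
have [r r0 rP] := compact_unif_continuous_mulmx L M cf e4.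
have PXL : \forall N \near F,
    (Pr [set w | r <= `|X N w - L *m V N w - 0|]%R < (e / (8 * b))%:E)%E.
  by apply: (cvge_near_lt (XLV _ r0)); rewrite lte_fin.
near=> N.
have mVN : random_vector (V N) by near: N.
have mXN : random_vector (X N) by near: N.
have mXLV : random_vector (fun w => X N w - L *m V N w).
  by apply: random_vectorB => //; exact: random_vector_mulmx.
have PV : (Pr [set w | M <= `|V N w|]%R <= (e / (8 * b))%:E)%E by near: N.
have PX : (Pr [set w | r <= `|X N w - L *m V N w - 0|]%R < (e / (8 * b))%:E)%E by near: N.
pose A1 := [set w | M <= `|V N w|].
pose A2 := [set w | r <= `|X N w - L *m V N w - 0|].
have mA1 : measurable A1 by exact: measurable_random_vector_norm.
have mA2 : measurable A2.
  by rewrite /A2; under eq_set do rewrite subr0; exact: measurable_random_vector_norm.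
have mA : measurable (A1 `|` A2) by exact: measurableU.
rewrite (le_trans (ler_distD (fine ('E_Pr[(fun w => f (L *m V N w))])%E) _ _))//.
(* One quarter for the convergence in law, one for the variation of [f] off the exceptional events,
   and a half for those events, each of probability at most [e / (8 * b)]. *)
rewrite (_ : e = e / 4 + (e / 4 + 2 * b * (e / (4 * b)))); last by field; rewrite gt_eqF.
rewrite lerD//; first by near: N; exact: fVW.
rewrite distrC (le_trans (@expectation_diff_le _ _ _ Pr _ _ b (e / 4) (A1 `|` A2) _ _ _ _ _ _ _))//.
- by near: N.
- exact: (measurable_continuous_random_vector mVN cfL).
- exact: ltW.
- move=> w /not_orP[/negP]; rewrite -ltNge => VM /negP; rewrite -ltNge subr0 => XV.
  by apply: rP => //; exact: ltW.
- rewrite lerD2l ler_wpM2l//; first by rewrite mulr_ge0// ltW.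
  rewrite -lee_fin fineK; last exact: fin_num_measure.
  rewrite (le_trans (measureU2 _ mA1 mA2))//.
  rewrite (_ : e / (4 * b) = e / (8 * b) + e / (8 * b)); last by field; rewrite gt_eqF.
  by rewrite EFinD leeD// ltW.
Unshelve. all: by end_near. Qed.

End convergence_in_distribution.

(** * First-order expansions *)

Section directional_derivatives.
Context {R : realType} {V : normedModType R}.

(** Both sides have the same difference quotient; one-variable calculus thereby applies to
    directional derivatives. *)
Lemma is_derive_line (f : V -> R) (x v : V) (t df : R) :
  is_derive (x + t *: v) v f df <-> is_derive t 1 (fun s => f (x + s *: v)) df.
Proof.
suff E : (fun h => h^-1 *: ((f \o shift (x + t *: v)) (h *: v) - f (x + t *: v))) =
    (fun h => h^-1 *: (((fun s => f (x + s *: v)) \o shift t) (h *: 1) - f (x + t *: v))).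
  split=> -[]; rewrite /derivable /derive => d1 d2; split; rewrite /derivable /derive.
  - by move: d1; rewrite E.
  - by move: d2; rewrite E.
  - by rewrite E.
  - by rewrite E.
apply/funext => h /=; congr (_ *: (f _ - _)).
by rewrite addrCA -scalerDl [h *: 1]mulr1.
Qed.

(** The step [c] may have either sign, hence the symmetric range of [s] and the two applications of
    the mean value theorem. *)
Lemma mvt_direction (f : V -> R) (x v : V) (c : R) :
  (forall s : R, `|s| <= `|c| -> derivable f (x + s *: v) v) ->
  exists2 s, `|s| <= `|c| & f (x + c *: v) - f x = c * 'D_v f (x + s *: v).
Proof.
move=> df; pose phi (s : R) := f (x + s *: v).
have dphi (s : R) : `|s| <= `|c| -> is_derive s 1 phi ('D_v f (x + s *: v)).
  by move=> sc; apply/is_derive_line; apply/derivableP/df.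
have phi0 : phi 0 = f x by rewrite /phi scale0r addr0.
have cphi (a b : R) : (forall s : R, s \in `[a, b] -> `|s| <= `|c|) ->
    {within `[a, b], continuous phi}.
  move=> abc; apply: derivable_within_continuous => s /abc/dphi.
  by case.
have [c0|c0] := leP 0 c.
  have H (s : R) : s \in `[0, c] -> `|s| <= `|c|.
    by rewrite in_itv/= => /andP[s0 sc]; rewrite !ger0_norm.
  have [s sc phis] := MVT_segment c0 (fun s sc => dphi s (H s (subset_itv_oo_cc sc))) (cphi _ _ H).
  by exists s; [exact: H|rewrite -phi0 phis subr0 mulrC].
have H (s : R) : s \in `[c, 0] -> `|s| <= `|c|.
  by rewrite in_itv/= => /andP[sc s0]; rewrite !ler0_norm ?lerN2// ltW.
have [s sc phis] := MVT_segment (ltW c0) (fun s sc => dphi s (H s (subset_itv_oo_cc sc))) (cphi _ _ H).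
exists s; first exact: H.
by rewrite -[LHS]opprK opprB -phi0 phis sub0r mulrN opprK mulrC.
Qed.

(** Near [x] the absolute value is the identity or the opposite, and in both cases the derivative of
    [ln] of it is [x^-1]. *)
Lemma is_derive_log2_norm1 (x : R) : x != 0 ->
  is_derive x 1 (fun y : R => log2 `|y|) (x * ln 2)^-1.
Proof.
move=> x0.
suff H : is_derive x 1 (fun y : R => ln `|y|) x^-1.
  have -> : (fun y : R => log2 `|y|) = (ln 2)^-1 *: (fun y : R => ln `|y|).
    by apply/funext => y; rewrite /log2 mulrC.
  by apply: is_derive_eq; rewrite invfM mulrC.
have [xn|xp|xe] := ltgtP x 0; last by rewrite xe eqxx in x0.
  refine (@near_eq_is_derive R R R (fun y => ln (- y)) _ _ _ _ _ _).
    by near=> y; rewrite /= ltr0_norm//; near: y; exact: lt_nbhsl.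
  have nx : 0 < - x by rewrite oppr_gt0.
  have := @is_derive1_comp _ (@ln R) -%R x (- x)^-1 (-1) (is_derive1_ln nx) _.
  by rewrite invrN mulrNN mulr1; apply.
refine (@near_eq_is_derive R R R (@ln R) _ _ _ _ _ _); last exact: is_derive1_ln.
by near=> y; rewrite gtr0_norm//; near: y; exact: lt_nbhsr.
Unshelve. all: by end_near. Qed.

Lemma is_derive_log2_norm (f : V -> R) (x v : V) : f x != 0 -> derivable f x v ->
  is_derive x v (fun y => log2 `|f y|) ((f x * ln 2)^-1 * 'D_v f x).
Proof.
move=> fx0 dfx.
(* The base point is written [x + 0 *: v] to restrict [f] to a line, where the one-variable chain
   rule is available. *)
have /is_derive_line H : is_derive (x + 0 *: v) v f ('D_v f x).
  by rewrite scale0r addr0; exact: derivableP.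
have : is_derive (x + 0 *: v) v (fun y => log2 `|f y|) ((f x * ln 2)^-1 * 'D_v f x).
  apply/is_derive_line.
  have -> : (fun s : R => log2 `|f (x + s *: v)|) =
    (fun y : R => log2 `|y|) \o (fun s => f (x + s *: v)) by [].
  apply: is_derive1_comp.
  by rewrite scale0r addr0; exact: is_derive_log2_norm1.
by rewrite scale0r addr0.
Qed.

End directional_derivatives.

Lemma is_derive1_expansion (R : realType) (f : R -> R) (x df : R) :
  is_derive x 1 f df -> forall a : R, 0 < a ->
  \forall s \near (0 : R), `|f (x + s) - f x - df * s| <= a * `|s|.
Proof.
move=> [dfx <-] a a0.
have := (@cvgrPdist_le _ _ _ _ (dnbhs_filter (0 : R)) _ _).1 dfx a a0.
rewrite near_withinE; apply: (@filterS _ _ (nbhs_filter (0 : R))) => s.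
have [->|s0 /(_ isT)] := eqVneq s 0; first by rewrite addr0 subrr mulr0 subrr normr0 mulr0.
rewrite -/(derive f x 1) /= [s%:A]mulr1 (addrC s) => H.
rewrite (_ : _ - _ - _ = - ('D_1 f x - s^-1 * (f (x + s) - f x)) * s).
  by rewrite normrM normrN ler_wpM2r.
by field.
Qed.

Section gradient.
Context {R : realType} {d : nat}.
Implicit Types (f : 'cV[R]_d -> R) (x y : 'cV[R]_d).

(** Partial derivatives that exist near [x] and are continuous at [x] give a first-order expansion:
    the mean value theorem is applied on each of [d] segments parallel to the axes. *)
Lemma partial_expansion f x :
  (\forall y \near x, forall l, derivable f y (delta_mx l 0)) ->
  (forall l, {for x, continuous (fun y => 'D_(delta_mx l 0) f y)}) ->
  forall e : R, 0 < e ->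
  \forall y \near x,
    `|f y - f x - ((gradient f x)^T *m (y - x)) 0 0| <= e * `|y - x|.
Proof.
(* Each of the [d] segments contributes an error of at most [e'] times the norm of [y - x]; the
   denominator [d.+1] stays positive for [d = 0]. *)
move=> df cdf e e0; pose e' := e / d.+1%:R.
have e'0 : 0 < e' by rewrite divr_gt0.
have cdf' : \forall y \near x,
    forall l, `|'D_(delta_mx l 0) f x - 'D_(delta_mx l 0) f y| < e'.
  apply: (@filter_forall _ _ (fun l y =>
    `|'D_(delta_mx l 0) f x - 'D_(delta_mx l 0) f y| < e') _ (nbhs_filter x)) => l.
  by have /(@cvgrPdist_lt _ _ _ _ (nbhs_filter x)) := cdf l; exact.
have [r /= r0 rP] := (nbhs_ballP _ _).1 (@filterI _ _ (nbhs_filter x) _ _ df cdf').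
apply/nbhs_ballP; exists r => //= y; rewrite mx_norm_ball/= distrC => yr.
pose D := y - x.
(* Move from [x] to [y] one coordinate at a time. *)
pose pt (k : nat) : 'cV[R]_d := x + \col_i (if (i < k)%N then D i 0 else 0).
have pt0 : pt 0%N = x.
  by apply/colP => i; rewrite !mxE addr0.
have ptd : pt d = y.
  by apply/colP => i; rewrite !mxE ltn_ord addrC subrK.
have ptS (k : 'I_d) : pt k.+1 = pt k + D k 0 *: delta_mx k 0.
  apply/colP => i; rewrite !mxE eqxx andbT ltnS -addrA; congr (_ + _).
  have [->|ik] := eqVneq i k; first by rewrite leqnn ltnn add0r mulr1.
  by rewrite mulr0 addr0 leq_eqVlt (negbTE (ik : nat_of_ord i != k)).
(* Every coordinate of such a point differs from that of [x] by at most the same coordinate of [D],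
   so the sup norm keeps the path inside the ball. *)
have ptr (k : 'I_d) s : `|s| <= `|D k 0| -> ball x r (pt k + s *: delta_mx k 0).
  move=> sD; rewrite mx_norm_ball/= (le_lt_trans _ yr)//.
  rewrite opprD addrA opprD addNKr -opprD normrN.
  apply: mx_norm_le => // i j; rewrite !mxE ord1 eqxx andbT.
  have [->|ik] := eqVneq i k.
    by rewrite ltnn add0r mulr1 (le_trans sD)// coord_le_mx_norm.
  rewrite mulr0 addr0; case: ifP => _; rewrite ?normr0//.
  by have := coord_le_mx_norm D i 0; rewrite !mxE.
have step (k : 'I_d) :
    `|f (pt k.+1) - f (pt k) - 'D_(delta_mx k 0) f x * D k 0| <= e' * `|D|.
  have [|s sD fs] := @mvt_direction _ _ f (pt k) (delta_mx k 0) (D k 0).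
    by move=> s sD; apply: (rP _ (ptr k s sD)).1.
  rewrite ptS fs mulrC -mulrBl normrM ler_pM//; last exact: coord_le_mx_norm.
  by rewrite distrC ltW//; exact: (rP _ (ptr k s sD)).2.
have -> : f y - f x = \sum_(k < d) (f (pt k.+1) - f (pt k)).
  by rewrite -(big_mkord xpredT (fun k => f (pt k.+1) - f (pt k))) telescope_sumr// ptd pt0.
rewrite mxE -sumrB.
rewrite (le_trans (ler_norm_sum _ _ _))//.
rewrite (@le_trans _ _ (\sum_(k < d) e' * `|D|))//.
  by apply: ler_sum => k _; have := step k; rewrite !mxE.
rewrite sumr_const card_ord -mulr_natl mulrA ler_wpM2r// /e' mulrCA.
by rewrite ler_piMr ?(ltW e0)// ler_pdivrMr// mul1r ler_nat.
Unshelve. all: by end_near. Qed.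

End gradient.

(* Here [k u] is the derivative of [h u] at 0, and [g u] the gradient of [G u]. *)
Lemma score_equation_expansion (R : realType) (d : nat) (I : finType)
    (G : I -> 'cV[R]_d -> R) (g : I -> 'cV[R]_d -> 'cV[R]_d) (x : 'cV[R]_d)
    (h : I -> R -> R) (k : I -> R) :
  let gram := \sum_u g u x *m (g u x)^T in
  gram \in unitmx ->
  (forall u (e : R), 0 < e -> \forall y \near x,
     `|G u y - G u x - ((g u x)^T *m (y - x)) 0 0| <= e * `|y - x|) ->
  (forall u, {for x, continuous (g u)}) ->
  (forall u (e : R), 0 < e -> \forall s \near (0 : R), `|h u s - k u * s| <= e * `|s|) ->
  forall e : R, 0 < e -> exists2 r : R, 0 < r &
    forall y (s : I -> R) (b : R), `|y - x| < r -> 0 <= b < r ->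
      (forall u, `|s u| <= b) ->
      \sum_u (h u (s u) - (G u y - G u x)) *: g u y = 0 ->
      `|y - x - invmx gram *m (\sum_u (k u * s u) *: g u x)| <= e * b.
Proof.
move=> gram Ugram HG Hg Hh e e0.
pose K := \sum_u (`|g u x| + `|k u|).
have K0 : 0 <= K by apply: sumr_ge0 => u _; rewrite addr_ge0.
have gkK u : `|g u x| + `|k u| <= K.
  by rewrite /K (bigD1 u)//= lerDl sumr_ge0// => v _; rewrite addr_ge0.
have gK u : `|g u x| <= K by rewrite (le_trans _ (gkK u))// lerDl.
have kK u : `|k u| <= K by rewrite (le_trans _ (gkK u))// lerDr.
pose n : R := #|I|%:R; have n0 : 0 <= n by [].
pose c := d%:R * `|invmx gram|; have c0 : 0 <= c by rewrite mulr_ge0.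
(* [C1] bounds one summand of the residual of the linearized equation, [C2] the residual after
   summation and inversion of [gram], and [C3] the main term relative to [b]. *)
pose C1 := K * (d%:R + 2) + 2.
have C10 : 0 <= C1 by rewrite addr_ge0// mulr_ge0// addr_ge0.
pose C2 := c * (n * C1) + 1.
have C21 : 1 <= C2 by rewrite lerDr !mulr_ge0.
pose C3 := c * (n * (K * K)).
have C30 : 0 <= C3 by rewrite !mulr_ge0.
(* This choice gives [C2 * e' <= 1 / 2], used to absorb the norm of [D], and
   [C2 * e' * (2 + 2 * C3) <= e], the final bound. *)
pose e' := Num.min e 1 / (C2 * (2 + 2 * C3)).
have C2p : 0 < C2 by rewrite (lt_le_trans _ C21).
have C3p : 0 < 2 + 2 * C3 by rewrite ltr_pwDl// mulr_ge0.
have e'0 : 0 < e' by rewrite divr_gt0 ?mulr_gt0// lt_min e0 ltr01.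
have e'C : C2 * e' * (2 + 2 * C3) = Num.min e 1.
  by rewrite /e'; field; rewrite !gt_eqF.
have e'e : C2 * e' * (2 + 2 * C3) <= e by rewrite e'C ge_min lexx.
have e'2 : C2 * e' * 2 <= 1.
  rewrite (@le_trans _ _ (C2 * e' * (2 + 2 * C3)))//.
    apply: ler_wpM2l; first by apply: mulr_ge0; exact: ltW.
    by rewrite lerDl mulr_ge0.
  by rewrite e'C ge_min lexx orbT.
have e'1 : e' <= 1.
  rewrite (le_trans _ e'2)// mulrAC ler_peMl// ?(ltW e'0)//.
  by rewrite mulr_ege1// ler1n.
clearbody e'.
have HG' : \forall y \near x, forall u,
    `|G u y - G u x - ((g u x)^T *m (y - x)) 0 0| <= e' * `|y - x|.
  by apply: (@filter_forall _ _ (fun u y => `|G u y - G u x - ((g u x)^T *m (y - x)) 0 0|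
    <= e' * `|y - x|) _ (nbhs_filter x)) => u; exact: HG.
have Hg' : \forall y \near x, forall u, `|g u x - g u y| <= e'.
  apply: (@filter_forall _ _ (fun u y => `|g u x - g u y| <= e') _ (nbhs_filter x)) => u.
  by have /(@cvgrPdist_le _ _ _ _ (nbhs_filter x)) := Hg u; exact.
have Hh' : \forall s \near (0 : R), forall u, `|h u s - k u * s| <= e' * `|s|.
  apply: (@filter_forall _ _ (fun u s => `|h u s - k u * s| <= e' * `|s|) _ (nbhs_filter (0 : R))) => u.
  exact: Hh.
have [r1 /= r10 r1P] := (nbhs_ballP _ _).1 (@filterI _ _ (nbhs_filter x) _ _ HG' Hg').
have [r2 /= r20 r2P] := (nbhs_ballP _ _).1 Hh'.
exists (Num.min r1 r2) => [|y s b]; first by rewrite lt_min r10.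
rewrite !lt_min => /andP[yr1 _] /and3P[b0 _ br2] sb E0.
have [{}HG {}Hg] : (forall u, `|G u y - G u x - ((g u x)^T *m (y - x)) 0 0| <= e' * `|y - x|)
    /\ forall u, `|g u x - g u y| <= e'.
  by apply: r1P; rewrite mx_norm_ball/= distrC.
have {}Hh u : `|h u (s u) - k u * s u| <= e' * b.
  rewrite (le_trans (r2P (s u) _ u))//; last by rewrite ler_wpM2l// ltW.
  by rewrite -ball_normE/= sub0r normrN (le_lt_trans (sb u)).
set D := y - x in HG *; set S := \sum_u (k u * s u) *: g u x.
pose p u := ((g u x)^T *m D) 0 0.
have gramD : gram *m D = \sum_u p u *: g u x.
  rewrite mulmx_suml; apply: eq_bigr => u _.
  by rewrite -mulmxA [(g u x)^T *m D]mx11_scalar mul_mx_scalar.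
have pD u : `|p u| <= d%:R * K * `|D|.
  rewrite (le_trans (coord_le_mx_norm _ _ _))// (le_trans (mx_norm_mulmx _ _))//.
  by rewrite mx_norm_trmx ler_wpM2r// ler_wpM2l.
have GD u : `|G u y - G u x| <= (d%:R * K + 1) * `|D|.
  rewrite -[G u y - G u x](subrK (p u)) (le_trans (ler_normD _ _))// mulrDl addrC lerD//.
  by rewrite (le_trans (HG u))// ler_wpM2r.
have hb u : `|h u (s u)| <= (K + 1) * b.
  rewrite -[h u (s u)](subrK (k u * s u)) (le_trans (ler_normD _ _))// mulrDl addrC lerD//.
    by rewrite normrM ler_pM.
  by rewrite (le_trans (Hh u))// ler_wpM2r.
(* [S - gram *m D] minus the left-hand side of the score equation: every
   summand is now a product with one factor of order [e']. *)
have SD : S - gram *m D = \sum_u ((k u * s u - h u (s u) + (G u y - G u x - p u)) *: g u x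
    + (h u (s u) - (G u y - G u x)) *: (g u x - g u y)).
  rewrite -[LHS]subr0 -[X in _ - X]E0 gramD /S -!sumrB; apply: eq_bigr => u _.
  rewrite scalerBr addrA -scalerDl -scalerBl; congr (_ *: _ - _).
  ring.
have SDn : `|S - gram *m D| <= n * C1 * e' * (b + `|D|).
  rewrite SD (le_trans (ler_norm_sum _ _ _))//.
  rewrite (@le_trans _ _ (\sum_(u : I) C1 * e' * (b + `|D|)))//; last first.
    by rewrite sumr_const -[X in X <= _]mulr_natl !mulrA.
  apply: ler_sum => u _; rewrite (le_trans (ler_normD _ _))// !normrZ.
  rewrite (@le_trans _ _ ((e' * b + e' * `|D|) * K +
      ((K + 1) * b + (d%:R * K + 1) * `|D|) * e'))//.
    rewrite lerD// ler_pM//.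
      by rewrite (le_trans (ler_normD _ _))// lerD// distrC.
    by rewrite (le_trans (ler_normB _ _))// lerD.
  rewrite -subr_ge0 (_ : _ - _ = e' * (b * (d%:R * K + 1) + `|D| * (K + 1))).
    apply: mulr_ge0; first exact: ltW.
    by apply: addr_ge0; apply: mulr_ge0 => //; apply: addr_ge0 => //; apply: mulr_ge0.
  by rewrite /C1; ring.
have Dn : `|D - invmx gram *m S| <= C2 * e' * (b + `|D|).
  rewrite -normrN opprB -[X in _ - X](mulKmx Ugram) -mulmxBr.
  rewrite (le_trans (mx_norm_mulmx _ _))// -/c.
  rewrite (le_trans (ler_wpM2l c0 SDn))// /C2 !mulrA -subr_ge0.
  rewrite (_ : _ - _ = e' * (b + `|D|)); first by rewrite mulr_ge0 ?addr_ge0// ltW.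
  ring.
have Sn : `|invmx gram *m S| <= C3 * b.
  rewrite (le_trans (mx_norm_mulmx _ _))// -/c /C3 -mulrA ler_wpM2l//.
  rewrite (le_trans (ler_norm_sum _ _ _))//.
  rewrite (@le_trans _ _ (\sum_(u : I) K * K * b))//; last first.
    by rewrite sumr_const -[X in X <= _]mulr_natl !mulrA.
  apply: ler_sum => u _; rewrite normrZ normrM [leRHS]mulrAC ler_pM//.
  by rewrite ler_pM.
(* A priori bound: the norm of [D] also occurs on the right, but with factor [C2 * e' <= 1 / 2], so
   it moves to the left. *)
have DD : `|D| <= (1 + 2 * C3) * b.
  have : `|D| <= C2 * e' * (b + `|D|) + C3 * b.
    rewrite -{1}[D](subrK (invmx gram *m S)) (le_trans (ler_normD _ _))//.
    by rewrite lerD.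
  have : C2 * e' * 2 * (b + `|D|) <= 1 * (b + `|D|) by rewrite ler_wpM2r// addr_ge0.
  lra.
rewrite (le_trans Dn)//.
rewrite (@le_trans _ _ (C2 * e' * ((2 + 2 * C3) * b)))//; last first.
  by rewrite mulrA ler_wpM2r.
rewrite ler_wpM2l//; first by rewrite mulr_ge0// ltW.
lra.
Qed.

(** * Gradients of log-moduli and the score equation of least squares *)

Section smooth_criterion.
Context {R : realType} {d : nat}.
Implicit Types (f E : 'cV[R]_d -> R) (x y : 'cV[R]_d) (U : set 'cV[R]_d).

Lemma continuous_coord_cV n (f : 'cV[R]_d -> 'cV[R]_n) x :
  (forall i, {for x, continuous (fun y => f y i 0)}) -> {for x, continuous f}.
Proof.
move=> cf; apply/(@cvgrPdist_lt _ _ _ _ (nbhs_filter x)) => e e0.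
have : \forall y \near x, forall i, `|f x i 0 - f y i 0| < e.
  apply: (@filter_forall _ _ (fun i y => `|f x i 0 - f y i 0| < e) _ (nbhs_filter x)) => i.
  by have /(@cvgrPdist_lt _ _ _ _ (nbhs_filter x)) := cf i; exact.
apply: (@filterS _ _ (nbhs_filter x)) => y H.
by apply: mx_norm_lt => // i j; rewrite !mxE ord1.
Qed.

Lemma near_neq0 f x : {for x, continuous f} -> f x != 0 -> \forall y \near x, f y != 0.
Proof.
move=> cf fx0; have := @open_neq R 0; rewrite openE => /(_ (f x)).
by move=> /(_ fx0); exact: cf.
Qed.

(** Membership in [U] and nonvanishing of [E] are open conditions, so the chain rule formula holds
    on a whole neighbourhood of [x], as continuity of the gradient at [x] requires. *)
Lemma cont_diff_on_log2_norm k U E x : open U -> cont_diff_on k.+1 U E -> U x -> E x != 0 ->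
  \forall y \near x, forall l : 'I_d, is_derive y (delta_mx l 0)
    (fun z => log2 `|E z|) ((E y * ln 2)^-1 * 'D_(delta_mx l 0) E y).
Proof.
move=> oU [cE dE] Ux Ex.
have := @filterI _ _ (nbhs_filter x) _ _ (near_neq0 (cE x Ux) Ex) (open_nbhs_nbhs (conj oU Ux)).
apply: (@filterS _ _ (nbhs_filter x)) => y [Ey Uy] l.
by apply: is_derive_log2_norm => //; exact: (dE l).1.
Qed.

Lemma continuous_gradient_log2_norm k U E x : open U -> cont_diff_on k.+1 U E -> U x -> E x != 0 ->
  {for x, continuous (gradient (fun z => log2 `|E z|))}.
Proof.
move=> oU CE Ux Ex; have [cE dE] := CE.
apply: continuous_coord_cV => l.
have nE : {near x, (fun y => (E y * ln 2)^-1 * 'D_(delta_mx l 0) E y) =1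
    (fun y => gradient (fun z => log2 `|E z|) y l 0)}.
  apply: (@filterS _ _ (nbhs_filter x)) (cont_diff_on_log2_norm oU CE Ux Ex) => y /(_ l) dy.
  by rewrite mxE (@derive_val _ _ _ _ _ _ _ dy).
rewrite /prop_for /continuous_at -(nbhs_singleton nE).
apply: (@cvg_trans _ ((fun y => (E y * ln 2)^-1 * 'D_(delta_mx l 0) E y) @ x)).
  exact: (@near_eq_cvg _ _ _ (nbhs_filter x)) nE.
have ln2 : ln 2 != 0 :> R by rewrite gt_eqF// ln_gt0// ltr1n.
apply: (@cvgM _ _ _ (nbhs_filter x)).
  apply: (@cvgV _ _ _ (nbhs_filter x)); first by rewrite mulf_neq0.
  by apply: (@cvgMl _ _ _ (nbhs_filter x)); exact: cE.
(* [cont_diff_on] unfolds only on a constructor; both cases contain continuity of the partial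
   derivative. *)
by have [_] := dE l; case: (k) => [|k'] [cD _]; exact: cD.
Qed.

Lemma is_derive_big_sum (I : Type) (r : seq I) (F : I -> R -> R) (dF : I -> R) (t : R) :
  (forall u, is_derive t 1 (F u) (dF u)) ->
  is_derive t 1 (fun s => \sum_(u <- r) F u s) (\sum_(u <- r) dF u).
Proof.
move=> H; elim: r => [|u r IH].
  rewrite big_nil (_ : (fun _ => _) = cst 0); first exact: is_derive_cst.
  by apply/funext => s; rewrite big_nil.
rewrite big_cons (_ : (fun _ => _) = F u + (fun s => \sum_(u <- r) F u s)).
  exact: is_deriveD.
by apply/funext => s; rewrite big_cons.
Qed.

(** Fermat's rule on each coordinate line through [y]: the derivative at 0 of the restricted
    criterion is minus twice a coordinate of the sum. *)
Lemma least_squares_score (I : finType) (G : I -> 'cV[R]_d -> R) (a : I -> R) y :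
  (\forall z \near y, forall u (l : 'I_d), derivable (G u) z (delta_mx l 0)) ->
  (\forall z \near y, \sum_u (a u - G u y) ^+ 2 <= \sum_u (a u - G u z) ^+ 2) ->
  \sum_u (a u - G u y) *: gradient (G u) y = 0.
Proof.
move=> dG Gmin; apply/colP => l.
have [r /= r0 rP] := (nbhs_ballP _ _).1 (@filterI _ _ (nbhs_filter y) _ _ dG Gmin).
pose phi (t : R) := \sum_u (a u - G u (y + t *: delta_mx l 0)) ^+ 2.
have line (t : R) : t \in `]- r, r[ -> ball y r (y + t *: delta_mx l 0).
  rewrite in_itv/= -ltr_norml => tr; rewrite mx_norm_ball/= opprD addNKr normrN.
  apply: mx_norm_lt => // i j; rewrite !mxE; case: eqP => _; last by rewrite mulr0 normr0.
  by case: eqP => _; rewrite /= ?mulr0 ?normr0// mulr1.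
have dphi (t : R) : t \in `]- r, r[ -> is_derive t 1 phi
    (\sum_u - (2 * (a u - G u (y + t *: delta_mx l 0)) *
              'D_(delta_mx l 0) (G u) (y + t *: delta_mx l 0))).
  move=> /line/rP[dGt _]; apply: is_derive_big_sum => u.
  have /is_derive_line H := derivableP (dGt u l).
  have : is_derive t 1 ((cst (a u) - (fun s => G u (y + s *: delta_mx l 0))) ^+ 2)
    (2 * (a u - G u (y + t *: delta_mx l 0)) *: (0 - 'D_(delta_mx l 0) (G u) (y + t *: delta_mx l 0))).
    by apply: is_derive_eq; rewrite /= expr1.
  rewrite sub0r scalerN.
  by congr is_derive; apply/funext => s; rewrite /= !fctE.
have zero_in : (0 : R) \in `]- r, r[ by rewrite in_itv/= oppr_lt0 r0.
have Nrr : - r <= r by lra.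
have [_ phi0] : is_derive (0 : R) 1 phi 0.
  apply: (@derive1_at_min _ _ _ _ _ Nrr _ zero_in) => t tr; first by case: (dphi t tr).
  by have [_] := rP _ (line t tr); rewrite /phi scale0r addr0.
have [_] := dphi 0 zero_in; rewrite phi0 scale0r addr0 sumrN => /esym/eqP.
rewrite oppr_eq0 (_ : \sum_u _ = 2 * \sum_u (a u - G u y) * 'D_(delta_mx l 0) (G u) y).
  by rewrite mulf_eq0 pnatr_eq0/=; move=> /eqP E0; rewrite summxE mxE -[RHS]E0;
    apply: eq_bigr => u _; rewrite !mxE.
by rewrite mulr_sumr; apply: eq_bigr => u _; rewrite mulrA.
Qed.

End smooth_criterion.

(** * The sample wavelet spectrum *)

Section sample_spectrum_measurability.
Context {R : realType} {dT : measure_display} {T : measurableType dT} {p : nat}.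
Local Notation mu := (@lebesgue_measure R).

(** Tonelli's theorem handles the positive and negative parts separately; their difference is
    measurable in the extended reals, and so is its finite part. *)
Lemma measurable_Rintegral_section (f : R * T -> R) :
  measurable_fun [set: R * T] f ->
  measurable_fun [set: T] (fun w => Rintegral mu [set: R] (fun t => f (t, w))).
Proof.
move=> mf; apply: measurableT_comp => //.
under eq_fun do rewrite integralE.
have mEf : measurable_fun [set: R * T] (EFin \o f) by exact/measurable_EFinP.
have msec (g : R * T -> \bar R) : measurable_fun [set: R * T] g -> (forall z, 0 <= g z)%E ->
    measurable_fun [set: T] (fun w => \int[mu]_t g (t, w))%E.
  exact: (@measurable_fun_fubini_tonelli_G _ _ (measurableTypeR R) T R mu g).
apply: emeasurable_funB.
- rewrite (_ : (fun w => _) = (fun w => \int[mu]_t ((EFin \o f)^\+ (t, w)))%E).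
    by apply: msec => //; exact: measurable_funepos.
  by apply/funext => w; apply: eq_integral => t _; rewrite !funeposE.
- rewrite (_ : (fun w => _) = (fun w => \int[mu]_t ((EFin \o f)^\- (t, w)))%E).
    by apply: msec => //; exact: measurable_funeneg.
  by apply/funext => w; apply: eq_integral => t _; rewrite !funenegE.
Qed.

Variables (psi : R -> R) (Y : R -> T -> 'cV[R]_p).
Hypotheses (hpsi : wavelet_basis psi) (hY : measurable_process Y).

Lemma random_vector_wavelet_coef j k : random_vector (wavelet_coef psi Y j k).
Proof.
move=> i; rewrite /wavelet_coef; under eq_fun do rewrite mxE.
apply: (@measurable_Rintegral_section (fun z => wavelet psi j k z.1 * Y z.1 z.2 i 0)).
apply: measurable_funM; last exact: hY.
apply: (measurableT_comp _ measurable_fst).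
(* Membership in [Lfun] includes measurability of the wavelet. *)
have [/(_ j k) + _ _] := hpsi.
by rewrite inE => /andP[]; rewrite inE.
Qed.

Lemma measurable_sample_spectrum j N a b :
  measurable_fun [set: T] (fun w => sample_spectrum psi Y j N w a b).
Proof.
rewrite /sample_spectrum.
under eq_fun do rewrite mxE summxE.
apply: measurable_funM => //; apply: measurable_sum => k.
under eq_fun do rewrite mxE big_ord1 [X in _ * X]mxE.
by apply: measurable_funM; exact: random_vector_wavelet_coef.
Qed.

End sample_spectrum_measurability.

Lemma idx_scale_itv p j1 j2 (u : spectrum_index p j1 j2) : j1 < j2 ->
  j1 <= idx_scale u <= j2.
Proof.
move=> j12; rewrite /idx_scale lerDl/=.
have uj : (nat_of_ord (val u).2)%:Z <= (`|j2 - j1|%N)%:Z by rewrite lez_nat -ltnS ltn_ord.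
by rewrite -lerBrDl (le_trans uj)// gez0_abs// subr_ge0 ltW.
Qed.

(** From [N = 2 ^ j * K_j]. This trades the common normalization for that of each scale and is the
    source of the weights 2^(j/2) in the limit. *)
Lemma sqrt_Kscale (R : realType) j N :
  Num.sqrt (N%:R : R) = 2 `^ (j%:~R / 2) * Num.sqrt (Kscale R j N).
Proof.
rewrite powRrM powR12_sqrt ?powR_ge0// powR_intmul// -sqrtrM ?exprz_ge0//.
by rewrite /Kscale mulrC divfK// expfz_neq0.
Qed.

Section limit_vector_matrix.
Context {R : realType} {dT : measure_display} {T : measurableType dT}
  {T' : Type} {p d : nat}.
Variables (psi : R -> R) (Y : R -> T -> 'cV[R]_p)
  (Pr : 'cV[R]_d -> probability T R) (j1 j2 : int).
Local Notation index := (spectrum_index p j1 j2).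

(** The matrix of the linear map from Z to W, with index triples numbered by [enum_val], in the form
    that Slutsky's theorem takes. *)
Definition limit_matrix (Theta : 'cV[R]_d) : 'M[R]_(d, #|index|) :=
  invmx (Lambda_gram psi Y Pr j1 j2 Theta) *m
  \matrix_(l, k) let u : index := enum_val k in
    2 `^ ((idx_scale u)%:~R / 2) / ln 2 / spectrum_entry psi Y Pr u Theta *
    Lambda psi Y Pr u Theta l 0.

Lemma limit_vectorE Theta (Z : index -> T' -> R) w :
  limit_vector psi Y Pr j1 j2 Theta (fun u => Z u w) =
  limit_matrix Theta *m vec_of_family Z w.
Proof.
rewrite /limit_vector /limit_matrix -mulmxA; congr (_ *m _).
apply/colP => l; rewrite summxE mxE.
rewrite (reindex (fun k : 'I_#|index| => enum_val k))/=; last exact/onW_bij/enum_val_bij.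
apply: eq_bigr => k _; rewrite !mxE. ring.
Qed.

End limit_vector_matrix.

(** * Asymptotic normality of the estimator *)

Theorem theorem5p4 (R : realType) (p d : nat)
    (dT dT' : measure_display)
    (T : measurableType dT) (T' : measurableType dT')
    (Y : R -> T -> 'cV[R]_p)
    (Pr : 'cV[R]_d -> probability T R)
    (Xi : set 'cV[R]_d) (Theta0 : 'cV[R]_d)
    (psi : R -> R) (Npsi : nat) (j1 j2 : int)
    (Theta_hat : nat -> T -> 'cV[R]_d)
    (Q : probability T' R) (Z : spectrum_index p j1 j2 -> T' -> R)
    (hp : (2 <= p)%N) (hj : j1 < j2)
    (hXi : compact Xi) (hTheta0 : Xi Theta0)
    (* every Theta in Xi specifies the law of an OfBm *)
    (hY : measurable_process Y)
    (hmodel : forall Theta, Xi Theta -> exists H, ofbm (Pr Theta) Y H)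
    (hofbm1 : OFBM1 (Pr Theta0) Y)
    (hofbm2 : OFBM2 (Pr Theta0) Y)
    (hofbm3 : OFBM3 (Pr Theta0) Y)
    (hpsi : wavelet_conditions psi Npsi)
    (* i) *)
    (hi : interior Xi Theta0)
    (* ii) *)
    (hii : exists jstar : int, j1 <= jstar <= j2 /\
       forall Theta Theta', Xi Theta -> Xi Theta' -> Theta <> Theta' ->
         exists i1 i2 : 'I_p,
           `|wavelet_spectrum psi Y (Pr Theta) jstar i1 i2| <>
           `|wavelet_spectrum psi Y (Pr Theta') jstar i1 i2|)
    (* iii) *)
    (hiii : forall (i1 i2 : 'I_p) (j : int), j1 <= j <= j2 ->
       wavelet_spectrum psi Y (Pr Theta0) j i1 i2 <> 0)
    (* iv) *)
    (hiv : forall j : int, j1 <= j <= j2 ->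
       {within Xi, continuous (fun Theta => wavelet_spectrum psi Y (Pr Theta) j)} /\
       forall i1 i2 : 'I_p,
         cont_diff_on 3 (interior Xi)
           (fun Theta => wavelet_spectrum psi Y (Pr Theta) j i1 i2))
    (* v) *)
    (hv : 0 < \det (Lambda_gram psi Y Pr j1 j2 Theta0))
    (* the Gaussian vector Z and the known result about it *)
    (hZ : centered_gaussian_family Q
            (limit_covariance psi Y (Pr Theta0) j1 j2) Z)
    (hknown : sample_spectrum_clt (Pr Theta0) Y psi Npsi Q Z)
    (* the estimators *)
    (hhat_rv : forall N, sample_size R j1 j2 N ->
       random_vector (Theta_hat N) /\ forall w, Xi (Theta_hat N w))
    (hhat_min : forall N, sample_size R j1 j2 N ->
       {ae Pr Theta0, forall w, forall Theta, Xi Theta ->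
          (objective psi Y Pr j1 j2 N w (Theta_hat N w) <=
           objective psi Y Pr j1 j2 N w Theta)%E})
    (hhat_cvg : cvg_in_probability (Pr Theta0) Theta_hat
                  (sample_sizes R j1 j2) Theta0) :
  cvg_in_distribution (Pr Theta0)
    (fun N w => Num.sqrt (N%:R : R) *: (Theta_hat N w - Theta0))
    (sample_sizes R j1 j2)
    Q (fun w => limit_vector psi Y Pr j1 j2 Theta0 (fun u => Z u w)).
Proof.
set gram := Lambda_gram psi Y Pr j1 j2 Theta0.
pose E (u : spectrum_index p j1 j2) := spectrum_entry psi Y Pr u.
pose G u y := log2 `|E u y|.
(* [h u] is the log-spectrum increment as a function of the spectral error [s]; [k u] is its
   derivative at 0. *)
pose h u (s : R) := log2 `|E u Theta0 + s| - log2 `|E u Theta0|.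
pose k u : R := (E u Theta0 * ln 2)^-1.
pose L := limit_matrix psi Y Pr j1 j2 Theta0.
pose V N := vec_of_family (centered_spectrum psi Y (Pr Theta0) j1 j2 N).
pose S (u : spectrum_index p j1 j2) N w := sample_spectrum psi Y (idx_scale u) N w (idx_row u) (idx_col u).
pose X N w := Num.sqrt (N%:R : R) *: (Theta_hat N w - Theta0).
have FF : Filter (sample_sizes R j1 j2) by exact: within_filter.
have near_size : \forall N \near sample_sizes R j1 j2, sample_size R j1 j2 N.
  by apply: withinT.
have Ugram : gram \in unitmx by rewrite unitmxE unitfE gt_eqF.
have E0 u : E u Theta0 != 0 by apply/eqP; apply: hiii; exact: idx_scale_itv.
have oXi : open (interior Xi) by exact: open_interior.
have CE u : cont_diff_on 3 (interior Xi) (E u).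
  by have [_ +] := hiv (idx_scale u) (idx_scale_itv u hj); exact.
have hwb : wavelet_basis psi by case: hpsi => -[].
have mS u N : measurable_fun [set: T] (S u N) by exact: measurable_sample_spectrum.
have mV N : random_vector (V N).
  move=> i; rewrite /V /vec_of_family; under eq_fun do rewrite mxE.
  by apply: measurable_funM => //; apply: measurable_funB => //; exact: mS.
have mZ : random_vector (vec_of_family Z).
  move=> i; have [Zc _] := hZ.
  (* A coordinate is the linear combination whose coefficients form a unit vector, and normality
     includes measurability. *)
  have [mc _] := Zc (fun u => (u == enum_val i)%:R).
  apply: eq_measurable_fun mc => w _; rewrite mxE (bigD1 (enum_val i))//= eqxx mul1r.
  by rewrite big1 ?addr0// => u /negbTE ->; rewrite mul0r.
have mX : \forall N \near sample_sizes R j1 j2, random_vector (X N).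
  apply: filterS near_size => N /hhat_rv[mhat _].
  by apply: random_vectorZ; apply: random_vectorB => // i; exact: measurable_cst.
have [_ /(_ hZ) VZ] := hknown hY hofbm1 hofbm2 hofbm3 hpsi.
have -> : (fun w => limit_vector psi Y Pr j1 j2 Theta0 (fun u => Z u w)) =
    (fun w => L *m vec_of_family Z w) by apply/funext => w; exact: limit_vectorE.
apply: (slutsky (V := V)) => //; first by apply: nearW.
move=> e e0.
have HG u (a : R) : 0 < a -> \forall y \near Theta0,
    `|G u y - G u Theta0 - ((gradient (G u) Theta0)^T *m (y - Theta0)) 0 0| <= a * `|y - Theta0|.
  apply: partial_expansion => [|l].
    apply: (@filterS _ _ (nbhs_filter Theta0)) (cont_diff_on_log2_norm oXi (CE u) hi (E0 u)) => y dy l.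
    by case: (dy l).
  have := @continuous_comp _ _ _ _ (fun v : 'cV[R]_d => v l 0) _
    (continuous_gradient_log2_norm oXi (CE u) hi (E0 u)) (@coord_continuous _ _ _ l 0 _).
  by congr continuous_at; apply/funext => y; rewrite /= mxE.
have Hg u : {for Theta0, continuous (gradient (G u))}.
  exact: continuous_gradient_log2_norm oXi (CE u) hi (E0 u).
have Hh u (a : R) : 0 < a -> \forall s \near (0 : R), `|h u s - k u * s| <= a * `|s|.
  exact: is_derive1_expansion (is_derive_log2_norm1 (E0 u)) _.
pose c : R := \sum_(u : spectrum_index p j1 j2) 2 `^ ((idx_scale u)%:~R / 2).
have c0 : 0 <= c by apply: sumr_ge0 => u _; exact: powR_ge0.
have cu (u : spectrum_index p j1 j2) : 2 `^ ((idx_scale u)%:~R / 2) <= c.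
  by rewrite /c (bigD1 u)//= lerDl sumr_ge0// => v _; exact: powR_ge0.
have mXLV : \forall N \near sample_sizes R j1 j2, random_vector (fun w => X N w - L *m V N w - 0).
  apply: filterS mX => N mXN.
  by under eq_fun do rewrite subr0; apply: random_vectorB => //; exact: random_vector_mulmx.
apply/fine_cvgP; split.
  by apply: filterS mXLV => N mN; apply: fin_num_measure; exact: measurable_random_vector_norm.
apply/cvgrPdist_le => a a0; have a20 : 0 < a / 2 by rewrite divr_gt0.
have [M MP] := cvg_in_distribution_tight mZ (nearW _ mV) VZ a20.
(* Calibrated so that [e1] times [c] times the norm of [V N w] is below [e] when that norm is below
   [M]. The absolute value allows any sign of [M], and the [+ 1] keeps the denominator positive. *)
pose e1 := e / (2 * (c * `|M| + 1)).
have cM : 0 < 2 * (c * `|M| + 1) by rewrite mulr_gt0// ltr_wpDl// mulr_ge0.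
have e10 : 0 < e1 by rewrite divr_gt0.
have [r r0 rP] := score_equation_expansion Ugram HG Hg Hh e10.
(* The score is computed at the random point [Theta_hat N w], which therefore needs a neighbourhood
   of its own with these properties. *)
have good : \forall y \near Theta0, \forall z \near y,
    Xi z /\ forall u, E u z != 0 /\ forall l : 'I_d, derivable (G u) z (delta_mx l 0).
  apply: nbhs_interior; apply: (@filterI _ _ (nbhs_filter Theta0)); first exact: hi.
  apply: (@filter_forall _ _ (fun u z => E u z != 0 /\
      forall l : 'I_d, derivable (G u) z (delta_mx l 0)) _ (nbhs_filter Theta0)) => u.
  apply: (@filterI _ _ (nbhs_filter Theta0)).
    by apply: near_neq0 (E0 u); have [cE _] := CE u; exact: cE.
  apply: (@filterS _ _ (nbhs_filter Theta0)) (cont_diff_on_log2_norm oXi (CE u) hi (E0 u)) => y dy l.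
  by case: (dy l).
(* A small spectral error leaves the sample entries nonzero, so the objective avoids its default
   value [+oo]. *)
have S0 : \forall s \near (0 : R), forall u, E u Theta0 + s != 0.
  apply: (@filter_forall _ _ (fun u s => E u Theta0 + s != 0) _ (nbhs_filter (0 : R))) => u.
  have : \forall s \near (0 : R), `|E u Theta0| > `|s|.
    apply/nbhs_ballP; exists `|E u Theta0|; rewrite /= ?normr_gt0// => s.
    by rewrite -ball_normE/= sub0r normrN.
  apply: (@filterS _ _ (nbhs_filter (0 : R))) => s; apply: contraTneq => /eqP.
  by rewrite addr_eq0 => /eqP ->; rewrite normrN ltxx.
have [r1 /= r10 r1P] := (nbhs_ballP _ _).1 good.
have [r2 /= r20 r2P] := (nbhs_ballP _ _).1 S0.
pose rho := Num.min r (Num.min r1 r2).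
have rho0 : 0 < rho by rewrite !lt_min r0 r10.
have Phat : \forall N \near sample_sizes R j1 j2,
    (Pr Theta0 [set w | rho <= `|Theta_hat N w - Theta0|]%R < (a / 2)%:E)%E.
  by apply: (cvge_near_lt (hhat_cvg _ rho0)); rewrite lte_fin.
(* For such [N], tightness of the scaled spectral errors forces the unscaled ones below [rho]. *)
have large : \forall N \near sample_sizes R j1 j2, c * `|M| < rho * Num.sqrt (N%:R : R).
  apply: cvg_within; near=> N.
  rewrite [ltRHS]mulrC -ltr_pdivrMr// -[ltLHS]ger0_norm ?divr_ge0 ?mulr_ge0// ?ltW//.
  rewrite -sqrtr_sqr ltr_sqrt; first by near: N; exact: nbhs_infty_gtr.
  rewrite ltr0n; near: N; exact: nbhs_infty_gt.
near=> N.
have PV : (Pr Theta0 [set w | M <= `|V N w|]%R <= (a / 2)%:E)%E by near: N.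
have PT : (Pr Theta0 [set w | rho <= `|Theta_hat N w - Theta0|]%R < (a / 2)%:E)%E by near: N.
have sN : sample_size R j1 j2 N by near: N.
have cMN : c * `|M| < rho * Num.sqrt (N%:R : R) by near: N.
have mN : random_vector (fun w => X N w - L *m V N w - 0) by near: N.
have [mhat Xihat] := hhat_rv N sN.
have [B [mB PB0 subB]] := hhat_min N sN.
pose A1 := [set w | M <= `|V N w|].
pose A2 := [set w | rho <= `|Theta_hat N w - Theta0|].
have mA1 : measurable A1 by exact: measurable_random_vector_norm.
have mA2 : measurable A2.
  have mhat0 : random_vector (fun w => Theta_hat N w - Theta0).
    by apply: (random_vectorB mhat) => i; exact: measurable_cst.
  exact: measurable_random_vector_norm.
rewrite sub0r normrN ger0_norm ?fine_ge0// -lee_fin fineK; last first.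
  by apply: fin_num_measure; exact: measurable_random_vector_norm.
(* Off [A1], [A2] and the null set [B] where minimality may fail, the remainder is below [e]; the
   three probabilities add up to at most [a]. *)
apply: (@le_trans _ _ (Pr Theta0 (A1 `|` A2 `|` B))).
  apply: le_measure; rewrite ?inE//; first exact: measurable_random_vector_norm.
    by apply: measurableU => //; exact: measurableU.
  move=> w /= ew; apply: contrapT => /not_orP[/not_orP[/negP nA1 /negP nA2] nB].
  move: nA1 nA2; rewrite -!ltNge => VM; rewrite !lt_min => /and3P[yr yr1 yr2].
  have hmin : forall Theta, Xi Theta -> (objective psi Y Pr j1 j2 N w (Theta_hat N w) <=
      objective psi Y Pr j1 j2 N w Theta)%E.
    by apply: contrapT => nP; exact/nB/subB.
  set y := Theta_hat N w in yr yr1 yr2 hmin.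
  have ny : \forall z \near y, Xi z /\
      forall u, E u z != 0 /\ forall l : 'I_d, derivable (G u) z (delta_mx l 0).
    by apply: r1P; rewrite mx_norm_ball/= distrC.
  have [_ Ey] := @nbhs_singleton _ y _ ny.
  pose s u := S u N w - E u Theta0.
  have sq0 : 0 < Num.sqrt (N%:R : R) by rewrite sqrtr_gt0 ltr0n; case: sN.
  have sV u : Num.sqrt (N%:R : R) * s u = 2 `^ ((idx_scale u)%:~R / 2) *
      centered_spectrum psi Y (Pr Theta0) j1 j2 N u w.
    by rewrite (sqrt_Kscale R (idx_scale u)) -mulrA.
  (* By [sV], [b] bounds all spectral errors at once, since [c] dominates every weight 2^(j/2). *)
  pose b := c * `|V N w| / Num.sqrt (N%:R : R).
  have b0 : 0 <= b by rewrite divr_ge0// mulr_ge0.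
  have brho : b < rho.
    rewrite ltr_pdivrMr// (le_lt_trans _ cMN)// ler_wpM2l// (le_trans (ltW VM))//.
    exact: ler_norm.
  have [br br2] : b < r /\ b < r2 by move: brho; rewrite !lt_min => /and3P[].
  have sb u : `|s u| <= b.
    rewrite ler_pdivlMr// mulrC -[X in X * _]gtr0_norm// -normrM sV normrM.
    rewrite (ger0_norm (powR_ge0 _ _)) ler_pM ?powR_ge0//.
    by have := coord_le_mx_norm (V N w) (enum_rank u) 0; rewrite mxE enum_rankK.
  have SE u : S u N w = E u Theta0 + s u by rewrite addrC subrK.
  have Snz u : S u N w != 0.
    by rewrite SE; apply: r2P; rewrite -ball_normE/= sub0r normrN (le_lt_trans (sb u)).
  have objE z : (forall u, E u z != 0) -> objective psi Y Pr j1 j2 N w z =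
      (\sum_u (log2 `|S u N w| - G u z) ^+ 2)%:E.
    move=> Ez; rewrite /objective ifF//; apply/negbTE/existsPn => u.
    by rewrite (negbTE (Snz u)) (negbTE (Ez u)).
  (* Near [y] all parameters lie in [Xi] and the objective is finite, so global minimality over [Xi]
     makes [y] a local minimizer of a real sum of squares. *)
  have score : \sum_u (log2 `|S u N w| - G u y) *: gradient (G u) y = 0.
    apply: least_squares_score.
      by apply: (@filterS _ _ (nbhs_filter y)) ny => z [_ Ez] u; case: (Ez u).
    apply: (@filterS _ _ (nbhs_filter y)) ny => z [Xiz Ez].
    by have := hmin z Xiz; rewrite (objE y (fun u => (Ey u).1)) (objE z (fun u => (Ez u).1)).
  have Hb : `|y - Theta0 - invmx gram *m (\sum_u (k u * s u) *: gradient (G u) Theta0)|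
      <= e1 * b.
    apply: rP => //; first by rewrite b0 br.
    by rewrite -[RHS]score; apply: eq_bigr => u _; rewrite /h -SE opprB addrA subrK.
  move: ew; rewrite leNgt => /negP; apply.
  rewrite subr0.
  (* Scaling by the square root of [N] turns the linearized solution into exactly [L *m V N w]: by
     [sV], its coefficients become those of [limit_vector]. *)
  have -> : X N w - L *m V N w = Num.sqrt (N%:R : R) *: (y - Theta0 -
      invmx gram *m (\sum_u (k u * s u) *: gradient (G u) Theta0)).
    rewrite scalerBr; congr (_ - _).
    rewrite -limit_vectorE /limit_vector scalemxAr; congr (_ *m _).
    rewrite scaler_sumr; apply: eq_bigr => u _; rewrite scalerA; congr (_ *: _).
    by rewrite [RHS]mulrCA sV /k invfM; ring.
  rewrite normrZ gtr0_norm// (le_lt_trans (ler_wpM2l (ltW sq0) Hb))//.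
  have -> : Num.sqrt (N%:R : R) * (e1 * b) = e1 * (c * `|V N w|).
    by rewrite /b; field; rewrite gt_eqF.
  rewrite /e1 mulrAC ltr_pdivrMr// ltr_pM2l//.
  have : c * `|V N w| <= c * `|M| by rewrite ler_wpM2l// (le_trans (ltW VM)) ?ler_norm.
  have : 0 <= c * `|M| by rewrite mulr_ge0.
  lra.
rewrite (le_trans (measureU2 _ _ mB))//; first exact: measurableU.
rewrite [X in (_ + X <= _)%E]PB0 adde0 (le_trans (measureU2 _ mA1 mA2))// (splitr a) EFinD.
by rewrite leeD// ltW.
Unshelve. all: by end_near. Qed.
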